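(* Let $(Z,X)$ be a pair of real random variables with a continuous joint distribution, and let $p_{\mathrm{success}}(n,m,\alpha)$ denote its success probability. Then: (a) If $X$ is stochastically increasing positive dependent (SIPD) in $Z$, then for any $n\in\mathbb{N}$, any $m\in\{1,\dots,n\}$ and any $\alpha\in(0,1]$, $$p_{\mathrm{success}}(n,m,\alpha)\le p_{\mathrm{success}}(n+1,m,\alpha).$$ (b) For any $n\in\mathbb{N}$, any $\alpha\in(0,1]$ and any $m\in\{1,\dots,n-1\}$, $$p_{\mathrm{success}}(n,m,\alpha)\le p_{\mathrm{success}}(n,m+1,\alpha).$$ (c) For any $n\in\mathbb{N}$, any $m\in\{1,\dots,n\}$ and any $\alpha,\alpha'\in(0,1]$ with $\alpha\le\alpha'$, $$p_{\mathrm{success}}(n,m,\alpha)\le p_{\mathrm{success}}(n,m,\alpha').$$ (The SIPD condition is assumed only in part (a).)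
   Context: Setting. Let $(Z_1,X_1),\dots,(Z_n,X_n)$ be i.i.d. copies of $(Z,X)$. Order the $Z$-values as $Z_{1:n}\le\dots\le Z_{n:n}$ (ties have probability zero), and let $X_{\langle i\rangle}$ be the $X$-value attached to $Z_{i:n}$, i.e. $X_{\langle i\rangle}=X_k$ when $Z_{i:n}=Z_k$. Success probability. For $1\le m\le n$ and $\alpha\in(0,1]$, $$p_{\mathrm{success}}(n,m,\alpha):=\Pr\Bigl(\min_{1\le i\le m}X_{\langle i\rangle}\le x_\alpha^*\Bigr),$$ where $x_\alpha^*$ is such that $\Pr(X\le x_\alpha^* )=\alpha$ (with $x_1^*=+\infty$ allowed). It depends on the distribution of $(Z,X)$ only through its copula. SIPD: $X$ is SIPD in $Z$ if $\Pr(X>x\mid Z=z)\le\Pr(X>x\mid Z=z')$ for all real $x$ and all $z\le z'$ in the support of $Z$ (for a suitable version of the conditional distribution). *)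

(* Defs.v *)
From HB Require Import structures.
From mathcomp Require Export all_boot all_order all_algebra.
From mathcomp Require Export all_classical all_reals all_analysis.

Set Implicit Arguments.
Unset Strict Implicit.
Unset Printing Implicit Defensive.

Import Order.TTheory GRing.Theory Num.Theory.
Export numFieldNormedType.Exports.

Local Open Scope classical_set_scope.
Local Open Scope ring_scope.
Local Open Scope ereal_scope.

Section law_of_a_pair.
Context d (T : measurableType d) (R : realType) (P : probability T R).
Implicit Types Z X : {RV P >-> R}.

Definition rv_pair Z X (w : T) : R * R := (Z w, X w).

Definition joint_cdf Z X (p : R * R) : \bar R :=
  P [set w | (Z w <= p.1)%R /\ (X w <= p.2)%R].

Definition continuous_joint_distribution Z X : Prop :=
  continuous (joint_cdf Z X).

Definition rv_support Z : set R :=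
  [set z | forall U : set R, open U -> U z -> 0 < distribution P Z U].

(* [K z B] is a regular version of [Pr (X \in B | Z = z)]. *)
Definition conditional_distribution Z X (K : R.-pker R ~> R) : Prop :=
  forall A B : set R, measurable A -> measurable B ->
    P (Z @^-1` A `&` X @^-1` B) = \int[distribution P Z]_(z in A) K z B.

Definition SIPD Z X : Prop :=
  exists2 K : R.-pker R ~> R, conditional_distribution Z X K &
    forall x z z' : R, rv_support Z z -> rv_support Z z' -> (z <= z')%R ->
      K z [set` `]x, +oo[] <= K z' [set` `]x, +oo[].

End law_of_a_pair.

Definition mutually_independent d d' (T : measurableType d)
    (U : measurableType d') (R : realType) (P : probability T R)
    (I : finType) (Y : I -> T -> U) : Prop :=
  forall (J : {set I}) (A : I -> set U), (forall i, measurable (A i)) ->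
    P (\bigcap_(i in [set` J]) (Y i @^-1` A i)) =
    \prod_(i in J) P (Y i @^-1` A i).

(* The copies may live on a probability space other than that of [(Z, X)].
   Independence is between the pairs, not within them. *)
Definition iid_copies (R : realType) d0 (T0 : measurableType d0)
    (P0 : probability T0 R) (Z X : {RV P0 >-> R})
    d (T : measurableType d) (P : probability T R) n
    (Zs Xs : 'I_n -> {RV P >-> R}) : Prop :=
  mutually_independent P (fun i => rv_pair (Zs i) (Xs i)) /\
  forall (i : 'I_n) (A : set (R * R)), measurable A ->
    P (rv_pair (Zs i) (Xs i) @^-1` A) = P0 (rv_pair Z X @^-1` A).

Section concomitants.
Context (R : realType) (n : nat).
Implicit Types z x : 'I_n -> R.

(* The index [i] is 1-based; only [1 <= i <= n] is meaningful. *)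
Definition order_stat z (i : nat) : R :=
  nth 0%R (sort <=%R (codom z)) i.-1.

(* If [z] has ties, [pick] selects one of the candidate indices [k]. *)
Definition concomitant z x (i : nat) : R :=
  if [pick k | order_stat z i == z k] is Some k then x k else 0%R.

(* Taken in [\bar R] so that [+oo] is the neutral element of [min]. *)
Definition min_concomitant z x (m : nat) : \bar R :=
  \big[Order.min/+oo]_(1 <= i < m.+1) (concomitant z x i)%:E.

End concomitants.

Definition success_probability (R : realType) d (T : measurableType d)
    (P : probability T R) n (Zs Xs : 'I_n -> {RV P >-> R})
    (m : nat) (x : \bar R) : \bar R :=
  P [set w | min_concomitant (fun k => Zs k w) (fun k => Xs k w) m <= x].

Definition quantile_choice (R : realType) d (T : measurableType d)
    (P : probability T R) (X : {RV P >-> R}) (xstar : R -> \bar R) : Prop :=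
  forall alpha : R, (0 < alpha <= 1)%R ->
    P [set w | (X w)%:E <= xstar alpha] = alpha%:E.

(* Main.v *)
Require Import Defs.
From mathcomp Require Import measurable_realfun.
Import Order.TTheory GRing.Theory Num.Theory.
Local Open Scope ring_scope.
Local Open Scope ereal_scope.

(** Part (a) compares failure probabilities after discretising Z.  The joint
    law has no atoms in its first marginal, so for every N the line splits into
    N consecutive cells of mass 1/N.  Let S_i be the conditional probability of
    X > x in cell i; under SIPD, S is nondecreasing.  Up to the O(n^2/N)
    probability that two sample points share a cell, the sample of size n fails
    with probability N^-n times the sum, over all assignments of n points to
    cells, of the product of the m smallest S-values.  Forgetting one of n+1
    points can only increase that product, so the average over n+1 points is at
    most the average over n points; then N tends to infinity.  Parts (b) and (c)
    are inclusions of events. *)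

Set Implicit Arguments.
Unset Strict Implicit.
Unset Printing Implicit Defensive.

Local Open Scope classical_set_scope.

(** * Positions of the smallest values in a finite family *)

Section FirstIndices.
Local Open Scope nat_scope.
Context {disp : Order.disp_t} {V : orderType disp} {n : nat}.
Implicit Types z : 'I_n -> V.

(** Positions are recorded instead of values, so that a real sample and the vector of its cell
    numbers can be compared. There are exactly [m] of them even with ties, which the sort
    settles. *)
Definition first_indices z (m : nat) : {set 'I_n} :=
  [set k in take m (sort (relpre z <=%O) (enum 'I_n))].

Lemma first_indices_sort_uniq z : uniq (sort (relpre z <=%O) (enum 'I_n)).
Proof. by rewrite sort_uniq enum_uniq. Qed.

Lemma size_first_indices_sort z :
  size (sort (relpre z <=%O) (enum 'I_n)) = n.
Proof. by rewrite size_sort size_enum_ord. Qed.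

Lemma mem_first_indices_sort z k :
  k \in sort (relpre z <=%O) (enum 'I_n).
Proof. by rewrite mem_sort mem_enum. Qed.

Lemma card_first_indices z m : m <= n -> #|first_indices z m| = m.
Proof.
move=> lemn; rewrite cardsE.
have /card_uniqP -> : uniq (take m (sort (relpre z <=%O) (enum 'I_n))).
  exact/take_uniq/first_indices_sort_uniq.
by rewrite size_takel// size_first_indices_sort.
Qed.

Lemma first_indices_lower z m k l :
  k \in first_indices z m -> l \notin first_indices z m ->
  (z k <= z l)%O.
Proof.
rewrite !inE => kJ lJ.
set s := sort _ _ in kJ lJ.
have ss : sorted (relpre z <=%O) (take m s ++ drop m s).
  rewrite cat_take_drop; apply: sort_sorted => a b /=; exact: le_total.
have ld : l \in drop m s.
  have := mem_first_indices_sort z l.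
  by rewrite -/s -[s in l \in s](cat_take_drop m) mem_cat (negbTE lJ).
have tr : transitive (relpre z <=%O) by move=> a b c /=; exact: le_trans.
move: ss; rewrite sorted_pairwise// pairwise_cat => /and3P[/allrelP h _ _].
exact: (h k l kJ ld).
Qed.

End FirstIndices.

(** A weakly monotone [c] that separates the sample induces the same order relation on positions,
    hence the same sorted list. It serves to replace sample values by cell numbers when no two
    points share a cell. *)
Lemma eq_first_indices {disp disp' : Order.disp_t} {V : orderType disp}
    {V' : orderType disp'} (n m : nat) (z : 'I_n -> V) (c : V -> V') :
  {homo c : x y / (x <= y)%O} -> injective (c \o z) ->
  first_indices (c \o z) m = first_indices z m.
Proof.
move=> cle cinj; rewrite /first_indices.
suff -> : (relpre (c \o z) <=%O : rel _) = relpre z <=%O by [].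
apply: funext => i; apply: funext => j /=.
apply/idP/idP => [h|]; last exact: cle.
rewrite leNgt; apply/negP => zji.
have ij : i = j.
  by apply: cinj; apply/le_anti; rewrite /= h cle// ltW.
by rewrite ij ltxx in zji.
Qed.

(** * Concomitants in terms of ranks *)

Section Concomitants.
Context (R : realType) (n : nat).
Implicit Types z x : 'I_n.+1 -> R.

(** The [pick] reproduces the choice made by [concomitant] among tied positions. The result reads
    the sample only through the relation [r], that is, through finitely many booleans. Ranks start
    at 0 here. *)
Definition ranked_index (r : rel 'I_n.+1) (i : nat) : 'I_n.+1 :=
  let k := nth ord0 (sort r (enum 'I_n.+1)) i in
  odflt k [pick l | r k l && r l k].

Lemma order_stat_sort z i : (i < n.+1)%N ->
  order_stat z i.+1 =
  z (nth ord0 (sort (relpre z <=%R) (enum 'I_n.+1)) i).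
Proof.
move=> lein; rewrite /order_stat /= codomE sort_map (nth_map ord0)//.
by rewrite size_sort size_enum_ord.
Qed.

Lemma concomitantE z x i : (i < n.+1)%N ->
  concomitant z x i.+1 = x (ranked_index (relpre z <=%R) i).
Proof.
move=> lein; rewrite /concomitant /ranked_index order_stat_sort//.
set k := nth _ _ _.
under eq_pick => l do rewrite eq_le.
by case: pickP => //= /(_ k); rewrite lexx.
Qed.

Lemma ranked_index_inj z i : injective z ->
  ranked_index (relpre z <=%R) i =
  nth ord0 (sort (relpre z <=%R) (enum 'I_n.+1)) i.
Proof.
move=> zinj; rewrite /ranked_index; set k := nth _ _ _.
by case: pickP => //= l; rewrite -eq_le => /eqP/zinj.
Qed.

(** The bound on [a] accounts for the neutral element [+oo] of the minimum, which must exceed [a] as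
    well. *)
Lemma lt_min_concomitant z x m (a : \bar R) : a < +oo ->
  (a < min_concomitant z x m) =
  [forall i : 'I_m, a < (concomitant z x i.+1)%:E].
Proof.
move=> alt; rewrite /min_concomitant big_add1 /= big_mkord.
apply/idP/forallP => [h i|h].
  by apply: lt_le_trans h _; exact: bigmin_le_cond.
by apply/bigmin_gtP; split => // i _; exact: h.
Qed.

Lemma lt_min_concomitant_inj z x m (a : \bar R) :
  (m <= n.+1)%N -> injective z -> a < +oo ->
  (a < min_concomitant z x m) =
  [forall k in first_indices z m, a < (x k)%:E].
Proof.
move=> lemn zinj alt; rewrite lt_min_concomitant//.
set s := sort (relpre z <=%R) (enum 'I_n.+1).
have ssz : size s = n.+1 by rewrite size_sort size_enum_ord.
have E i : (i < m)%N -> concomitant z x i.+1 = x (nth ord0 s i).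
  move=> im; rewrite concomitantE; last exact: leq_trans im lemn.
  by rewrite ranked_index_inj.
apply/forallP/forall_inP => [h k|h i].
  rewrite inE -/s => /(nthP ord0)[i]; rewrite size_takel ?ssz// => im.
  by rewrite nth_take// => <-; rewrite -E//; exact: (h (Ordinal im)).
rewrite E//; apply: h; rewrite inE -/s -(nth_take ord0 (ltn_ord i)).
by apply: mem_nth; rewrite size_takel ?ssz.
Qed.

End Concomitants.

(** * The failure sum on a grid of cells *)

(** Exchange argument: after the common factors over [J :&: K] are set aside, [J :\: K] and
    [K :\: J] have equally many elements, and the largest factor over the first is at most every
    factor over the second. *)
Lemma prodr_lower_set_le (R : realDomainType) (I : finType) (S : I -> R)
    (J K : {set I}) :
  (forall k, 0 <= S k)%R ->
  (forall k l, k \in J -> l \notin J -> (S k <= S l)%R) ->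
  #|J| = #|K| ->
  (\prod_(k in J) S k <= \prod_(k in K) S k)%R.
Proof.
move=> S0 SJ cJK.
have cD : #|J :\: K| = #|K :\: J|.
  have := cardsID K J; have := cardsID J K.
  by rewrite finset.setIC -cJK => <- /eqP; rewrite eqn_add2l => /eqP.
rewrite (big_setID K) [leRHS](big_setID J) /= finset.setIC.
apply: ler_wpM2l; first by apply: prodr_ge0 => k _.
have [JK0|[j0 j0J]] := set_0Vmem (J :\: K).
  have /eqP : #|K :\: J| = 0%N by rewrite -cD JK0 cards0.
  by rewrite cards_eq0 JK0 => /eqP ->; rewrite !big_set0.
have [j jJ jmax] := Order.TotalTheory.arg_maxP S j0J.
apply: (@le_trans _ _ (\prod_(k in J :\: K) S j)%R).
  by apply: ler_prod => k kJ; rewrite S0 /=; exact: jmax.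
rewrite prodr_const cD -prodr_const; apply: ler_prod => k kK.
rewrite S0 SJ//=; first by have /finset.setDP[] := jJ.
by have /finset.setDP[] := kK.
Qed.

Section GridFailure.
Context {R : realDomainType} {N : nat}.
Variable S : 'I_N -> R.

(** This is [N ^ n] times the failure probability of [n] independent points uniform over the cells,
    when [S i] is the chance that a point of cell [i] exceeds the threshold. Leaving out the
    normalisation avoids division. *)
Definition grid_failure (m n : nat) : R :=
  (\sum_(a : {ffun 'I_n -> 'I_N})
     \prod_(k in first_indices (fun k => nat_of_ord (a k)) m) S (a k))%R.

Hypothesis S0 : forall i, (0 <= S i)%R.
Hypothesis Smono : forall i j : 'I_N, (i <= j)%N -> (S i <= S j)%R.

(* Forgetting the last point can only raise the product of the m smallest
   values, and each configuration of n points arises at most N times. *)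
Lemma grid_failure_succ_le (m n : nat) : (m <= n)%N ->
  (grid_failure m n.+1 <= N%:R * grid_failure m n)%R.
Proof.
move=> lemn; rewrite /grid_failure.
pose first_n (a : {ffun 'I_n.+1 -> 'I_N}) : {ffun 'I_n -> 'I_N} :=
  [ffun k => a (lift ord_max k)].
pose G n' (a : {ffun 'I_n' -> 'I_N}) :=
  (\prod_(k in first_indices (fun k => nat_of_ord (a k)) m) S (a k))%R.
have G0 n' a : (0 <= G n' a)%R by apply: prodr_ge0.
have Gle a : (G n.+1 a <= G n (first_n a))%R.
  have linj := @lift_inj n.+1 ord_max.
  (* Lifting past the deleted last position turns the indices chosen among [n] points into an
     [m]-element set of indices among [n.+1] points, a competitor of [first_indices]. *)
  have -> : G n (first_n a) = (\prod_(k in lift ord_max @: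
      first_indices (fun k => nat_of_ord (first_n a k)) m) S (a k))%R.
    rewrite big_imset /=; last by move=> x y _ _; exact: linj.
    by apply: eq_bigr => k _; rewrite ffunE.
  apply: prodr_lower_set_le => // [k l kJ lJ|].
    by apply: Smono; have := first_indices_lower kJ lJ.
  rewrite card_imset// !card_first_indices//; exact: leqW.
apply: (@le_trans _ _ (\sum_(a : {ffun 'I_n.+1 -> 'I_N}) G n (first_n a))%R).
  by apply: ler_sum => a _; exact: Gle.
rewrite (partition_big first_n predT)//= mulr_sumr; apply: ler_sum => b _.
rewrite (eq_bigr (fun=> G n b)); last by move=> a /eqP ->.
rewrite sumr_const -[leLHS]mulr_natl; apply: ler_wpM2r; first exact: (G0 n b).
rewrite ler_nat -[leqRHS]card_ord.
(* Within a fibre of [first_n], a configuration is determined by the cell of its last point. *)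
rewrite -(@card_in_imset _ _ (fun a : {ffun 'I_n.+1 -> 'I_N} => a ord_max)).
  exact: max_card.
move=> a a' fa fa' aa'; apply/ffunP => i.
have ab : first_n a = b by apply/eqP; exact: fa.
have a'b : first_n a' = b by apply/eqP; exact: fa'.
case: (unliftP ord_max i) => [j|] ->//.
by have /ffunP/(_ j) : first_n a = first_n a'; [rewrite ab|rewrite !ffunE].
Qed.

End GridFailure.

(** * Measurability of events about concomitants *)

Lemma measurable_finite_cases d (T : measurableType d) (F : finType)
    (f : T -> F) (A : F -> set T) :
  (forall a, measurable (f @^-1` [set a])) -> (forall a, measurable (A a)) ->
  measurable [set w | A (f w) w].
Proof.
move=> mf mA.
have -> : [set w | A (f w) w] = \bigcup_(a in setT) (f @^-1` [set a] `&` A a).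
  apply/seteqP; split => [w /= Aw|w [a _ [/= <-]]]//.
  by exists (f w).
by apply: fin_bigcup_measurable => // a _; exact: measurableI.
Qed.

Lemma measurable_lt_mfun d (T : measurableType d) (R : realType)
    (f : {mfun T >-> R}) (x : \bar R) : measurable [set w | x < (f w)%:E].
Proof.
rewrite -[X in measurable X]setTI.
by apply: emeasurable_fun_o_infty => //; exact/measurable_EFinP.
Qed.

Section MeasurableConcomitants.
Context d (T : measurableType d) (R : realType) (n : nat).
Variables Zs Xs : 'I_n.+1 -> {mfun T >-> R}.

(** A statistic with finitely many values that determines all ranks, ties included. *)
Let order_pattern w : {ffun 'I_n.+1 * 'I_n.+1 -> bool} :=
  [ffun p => (Zs p.1 w <= Zs p.2 w)%R].

Let measurable_order_pattern a : measurable (order_pattern @^-1` [set a]).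
Proof.
have -> : order_pattern @^-1` [set a] =
    \bigcap_(p in setT) ((fun w => Zs p.1 w <= Zs p.2 w)%R @^-1` [set a p]).
  apply/seteqP; split => [w /= <- p _|w h] /=; first by rewrite ffunE.
  by apply/ffunP => p; rewrite ffunE; exact: h.
apply: fin_bigcap_measurable => // p _.
rewrite -[X in measurable X]setTI.
by apply: measurable_fun_ler.
Qed.

(** Once the order pattern is fixed, each concomitant is a fixed coordinate of [Xs], so the event is
    a finite union of finite intersections of measurable sets. *)
Lemma measurable_lt_min_concomitant m (x : \bar R) : (m <= n.+1)%N ->
  measurable
    [set w | x < min_concomitant (fun k => Zs k w) (fun k => Xs k w) m].
Proof.
move=> lemn; have [->|xlt] := eqVneq x +oo.
  rewrite (_ : [set w | _] = set0)//; apply/seteqP; split => w //=.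
  by rewrite ltNge leey.
rewrite -ltey in xlt.
pose idx (a : {ffun 'I_n.+1 * 'I_n.+1 -> bool}) :=
  ranked_index (fun k l => a (k, l)).
have -> : [set w | x < min_concomitant (fun k => Zs k w) (fun k => Xs k w) m] =
    [set w | (\bigcap_(i in [set: 'I_m])
      [set w | x < (Xs (idx (order_pattern w) i) w)%:E]) w].
  have E w i : (i < m)%N -> concomitant (fun k => Zs k w) (fun k => Xs k w) i.+1
      = Xs (idx (order_pattern w) i) w.
    move=> im; rewrite concomitantE; last exact: leq_trans im lemn.
    congr (Xs (ranked_index _ _) _).
    by apply: funext => k; apply: funext => l; rewrite ffunE.
  apply/seteqP; split => w /=; rewrite lt_min_concomitant//.
    by move=> /forallP h i _ /=; rewrite -E.
  by move=> h; apply/forallP => i; rewrite E//; exact: h.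
apply: (measurable_finite_cases (A := fun a => \bigcap_(i in [set: 'I_m])
  [set w | x < (Xs (idx a i) w)%:E])) => // a.
by apply: fin_bigcap_measurable => // i _; exact: measurable_lt_mfun.
Qed.

Lemma measurable_min_concomitant_le m (x : \bar R) : (m <= n.+1)%N ->
  measurable
    [set w | min_concomitant (fun k => Zs k w) (fun k => Xs k w) m <= x].
Proof.
move=> lemn; have := measurable_lt_min_concomitant x lemn.
move=> /measurableC; congr measurable; apply/seteqP.
by split => w /=; rewrite leNgt => /negP.
Qed.

End MeasurableConcomitants.

(** * Monotonicity in [m] and in the threshold *)

Section SuccessProbability.
Context d (T : measurableType d) (R : realType) (P : probability T R) (n : nat).
Variables Zs Xs : 'I_n.+1 -> {RV P >-> R}.

Lemma success_probability_succ m (x : \bar R) : (m.+1 <= n.+1)%N ->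
  success_probability Zs Xs m x <= success_probability Zs Xs m.+1 x.
Proof.
move=> lemn; apply: le_measure; rewrite ?inE.
- by apply: measurable_min_concomitant_le; exact: ltnW.
- exact: measurable_min_concomitant_le.
move=> w /=; apply: le_trans.
by rewrite /min_concomitant [leLHS]big_nat_recr//= ge_min lexx.
Qed.

Lemma le_success_probability m (x y : \bar R) : (m <= n.+1)%N -> x <= y ->
  success_probability Zs Xs m x <= success_probability Zs Xs m y.
Proof.
move=> lemn xy; apply: le_measure; rewrite ?inE.
- exact: measurable_min_concomitant_le.
- exact: measurable_min_concomitant_le.
by move=> w /= /le_trans; exact.
Qed.

Lemma success_probabilityC m (x : \bar R) : (m <= n.+1)%N ->
  success_probability Zs Xs m x = 1 -
    P [set w | x < min_concomitant (fun k => Zs k w) (fun k => Xs k w) m].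
Proof.
move=> lemn; rewrite -probability_setC; last exact: measurable_lt_min_concomitant.
by congr (P _); apply/seteqP; split => w /=; rewrite leNgt => /negP.
Qed.

End SuccessProbability.

(** If the thresholds were strictly reversed, monotonicity of the measure would give [b <= a], hence
    [a = b], and one value of [xstar] would lie strictly below itself. *)
Lemma le_quantile_choice (R : realType) d (T : measurableType d)
    (P : probability T R) (X : {RV P >-> R}) (xstar : R -> \bar R)
    (a b : R) : quantile_choice X xstar ->
  (0 < a <= 1)%R -> (0 < b <= 1)%R -> (a <= b)%R -> xstar a <= xstar b.
Proof.
move=> hx a01 b01 ab; rewrite leNgt; apply/negP => xba.
have mE x : measurable [set w | (X w)%:E <= x].
  rewrite -[X in measurable X]setTI.
  apply: emeasurable_fun_infty_c => //.
  exact/measurable_EFinP.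
have ba : (b <= a)%R.
  rewrite -lee_fin -(hx _ a01) -(hx _ b01); apply: le_measure; rewrite ?inE//.
  by move=> w /= /le_trans; apply; exact: ltW.
have eab : a = b by apply/le_anti; rewrite ab.
by rewrite eab ltxx in xba.
Qed.

Lemma measurable_mfun_preimage d d' (T : measurableType d)
    (U : measurableType d') (f : {mfun T >-> U}) (A : set U) :
  measurable A -> measurable (f @^-1` A).
Proof.
by move=> mA; rewrite -[X in measurable X]setTI; exact: measurable_funPT.
Qed.

(** * Continuity of the joint law excludes atoms of [Z] *)

Section ContinuousLaw.
Context d (T : measurableType d) (R : realType) (P : probability T R).
Variables Z X : {RV P >-> R}.
Hypothesis hcont : continuous_joint_distribution Z X.

(** An atom of [Z] carrying mass on [X <= x] would make the joint distribution function jump at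
    [(z, x)]. Letting [x] run through the naturals then exhausts the whole event [Z = z]. *)
Lemma continuous_joint_no_atom (z : R) : P (Z @^-1` [set z]) = 0.
Proof.
have E0 x : P (Z @^-1` [set z] `&` X @^-1` `]-oo, x]) = 0.
  set E := _ `&` _.
  have mE : measurable E.
    by apply: measurableI; apply: measurable_mfun_preimage.
  have JE t : joint_cdf Z X (t, x) = P (Z @^-1` `]-oo, t] `&` X @^-1` `]-oo, x]).
    by congr (P _); apply/seteqP; split => w /=; rewrite !in_itv.
  have mJ t : measurable (Z @^-1` `]-oo, t] `&` X @^-1` `]-oo, x]).
    by apply: measurableI; apply: measurable_mfun_preimage.
  (* Any move to the left of [z], however small, loses the whole mass of [E]. *)
  have le t : (t < z)%R -> joint_cdf Z X (t, x) <= joint_cdf Z X (z, x) - P E.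
    move=> tz; rewrite leeBrDr ?fin_num_measure// !JE -measureU//.
      apply: le_measure; rewrite ?inE//; first exact: measurableU.
      move=> w /= [] [] /=; rewrite !in_itv/=.
        by move=> wt ->; rewrite (le_trans wt)// ltW.
      by move=> -> ->; rewrite lexx.
    rewrite -subset0 => w /= [[+ _] [wz _]]; rewrite in_itv/= wz.
    by rewrite leNgt tz.
  apply/eqP; rewrite eq_le measure_ge0 andbT leNgt; apply/negP => E_gt0.
  have : joint_cdf Z X (t, x) @[t --> z] --> joint_cdf Z X (z, x).
    have pc : (fun t => (t, x)) @ z --> (nbhs z, nbhs x).
      exact: (cvg_pair (f := id) (g := fun=> x) (@cvg_id _ _) (cvg_cst x)).
    exact: (cvg_comp _ _ pc (@hcont (z, x))).
  move=> /(_ [set y | joint_cdf Z X (z, x) - P E < y]).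
  have Jlt : joint_cdf Z X (z, x) - P E < joint_cdf Z X (z, x).
    by rewrite lteBlDr ?fin_num_measure// lteDl// JE fin_num_measure.
  move=> /(_ (open_ereal_gt' Jlt)) /nbhs_ballP[e /= e0 /(_ (z - e / 2)%R)] /=.
  have e2 : (0 < e / 2)%R by rewrite divr_gt0.
  rewrite -ball_normE /= opprB addrC subrK gtr0_norm// gtr_pMr// invf_lt1// ltr1n.
  move=> /(_ isT); apply/negP; rewrite -leNgt; apply: le.
  by rewrite ltrBlDr ltrDl.
have mz : measurable (Z @^-1` [set z]) by apply: measurable_mfun_preimage.
apply/(negligibleP _ mz).
have -> : Z @^-1` [set z] =
    \bigcup_k (Z @^-1` [set z] `&` X @^-1` `]-oo, k%:R]).
  apply/seteqP; split => [w /= wz|w [k _ []]//].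
  exists (Num.truncn (X w)).+1 => //; split => //=; rewrite in_itv/=.
  exact/ltW/truncnS_gt.
apply: negligible_bigcup => k; apply/negligibleP; last exact: E0.
by apply: measurableI => //; apply: measurable_mfun_preimage.
Qed.

End ContinuousLaw.

(** * Cells of equal mass *)

Section GridCells.
Context d (T : measurableType d) (R : realType) (P : probability T R).
Variable Z : {RV P >-> R}.
Hypothesis Z_no_atom : forall z, P (Z @^-1` [set z]) = 0.

(** The witness is the infimum [q] of the points where the distribution function is at least [t].
    Right continuity gives at least [t] at [q]. The mass strictly below [q] is at most [t], and [q]
    itself has no mass. *)
Lemma no_atom_cdf_surj (t : R) : (0 < t < 1)%R ->
  exists q, cdf Z q = t%:E.
Proof.
move=> /andP[t0 t1].
pose B := [set z | t%:E <= cdf Z z].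
have [z0 z0t] : exists z, cdf Z z < t%:E.
  have := @cvg_cdfNy0 _ _ _ P Z [set y | y < t%:E].
  move=> /(_ (open_ereal_lt' _)); rewrite lte_fin => /(_ t0) [M [_ h]].
  by exists (M - 1)%R; apply: h; rewrite /= ltrBlDr ltrDl.
have [z1 z1t] : exists z, t%:E < cdf Z z.
  have := @cvg_cdfy1 _ _ _ P Z [set y | t%:E < y].
  move=> /(_ (open_ereal_gt' _)); rewrite lte_fin => /(_ t1) [M [_ h]].
  by exists (M + 1)%R; apply: h; rewrite /= ltrDl.
have B0 : B !=set0 by exists z1; exact: ltW.
have lbB z : cdf Z z < t%:E -> lbound B z.
  move=> zt y; rewrite /B /= => ty; rewrite leNgt; apply/negP => yz.
  have := le_lt_trans (le_trans ty (cdf_nondecreasing Z (ltW yz))) zt.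
  by rewrite ltxx.
have hB : has_inf B by split => //; exists z0; exact: lbB.
pose q := inf B.
have ltq z : (z < q)%R -> cdf Z z < t%:E.
  move=> zq; rewrite ltNge; apply/negP => tz.
  by have := lt_le_trans zq (ge_inf hB.2 tz); rewrite ltxx.
exists q; apply/le_anti/andP; split; last first.
  rewrite leNgt; apply/negP => qt.
  have := @cdf_right_continuous _ _ _ P Z q [set y | y < t%:E].
  move=> /(_ (open_ereal_lt' qt)) /nbhs_ballP[e /= e0 /(_ (q + e / 2)%R)] /=.
  have e2 : (0 < e / 2)%R by rewrite divr_gt0.
  rewrite -ball_normE /= opprD addNKr normrN gtr0_norm// gtr_pMr// invf_lt1// ltr1n.
  move=> /(_ isT); rewrite ltrDl => /(_ e2) /lbB lbq.
  have := lb_le_inf B0 lbq; rewrite -/q leNgt => /negP; apply.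
  by rewrite ltrDl.
have mle x : measurable (Z @^-1` `]-oo, x]).
  exact: measurable_mfun_preimage.
pose F k := Z @^-1` `]-oo, (q - k.+1%:R^-1)%R].
have UF : \bigcup_k F k = Z @^-1` `]-oo, q[.
  apply/seteqP; split => [w [k _]|w] /=; rewrite /F /= !in_itv/=.
    by move=> wk; apply: (le_lt_trans wk); rewrite ltrBlDr ltrDl invr_gt0.
  (* This index [k] satisfies [k.+1%:R^-1 <= q - Z w]. *)
  move=> wq; exists (Num.truncn (q - Z w)^-1) => //=; rewrite in_itv/=.
  rewrite lerBrDl -lerBrDr -[leRHS]invrK lef_pV2 ?posrE ?invr_gt0 ?subr_gt0//.
  exact/ltW/truncnS_gt.
have mlt : measurable (Z @^-1` `]-oo, q[) by exact: measurable_mfun_preimage.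
have Plt : P (Z @^-1` `]-oo, q[) <= t%:E.
  rewrite -UF; apply: (@cvge_le _ _ eventually_filter _ (P \o F)); last first.
    apply: nondecreasing_cvg_mu; [by move=> k; exact: mle|by rewrite UF|].
    move=> i j ij; apply/subsetPset => w; rewrite /F /= !in_itv/= => /le_trans.
    apply; rewrite lerD2l lerN2 lef_pV2 ?posrE// ler_nat.
    by rewrite ltnS.
  apply: nearW => k /=; apply/ltW/ltq.
  by rewrite ltrBlDr ltrDl invr_gt0.
have -> : cdf Z q = P (Z @^-1` `]-oo, q]) by [].
rewrite (_ : _ @^-1` _ = Z @^-1` `]-oo, q[ `|` Z @^-1` [set q]).
  by rewrite measureU0//; exact: Z_no_atom.
apply/seteqP; split => w /=; rewrite !in_itv/= le_eqVlt.
  by move=> /orP[/eqP|]; [right|left].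
by move=> [->|->]; rewrite ?eqxx ?orbT.
Qed.

(** The [N] quantiles of levels [i.+1 / N.+1] cut the line into [N.+1] cells; [c z] counts the
    quantiles strictly below [z]. *)
Lemma no_atom_grid N : exists c : R -> 'I_N.+1,
  [/\ forall z z', (z <= z')%R -> (c z <= c z')%N,
      forall i, measurable (c @^-1` [set i]) &
      forall i, P (Z @^-1` (c @^-1` [set i])) = (N.+1%:R^-1)%:E].
Proof.
have /choice[q qE] : forall i : 'I_N, exists q,
    cdf Z q = ((i.+1)%:R / N.+1%:R)%:E.
  move=> i; apply: no_atom_cdf_surj; rewrite divr_gt0//=.
  by rewrite ltr_pdivrMr// mul1r ltr_nat ltnS ltn_ord.
have qlt (i j : 'I_N) : (i < j)%N -> (q i < q j)%R.
  move=> ij; rewrite ltNge; apply/negP => /(cdf_nondecreasing Z).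
  rewrite !qE lee_fin ler_pM2r ?invr_gt0// ler_nat ltnS.
  by rewrite leqNgt ij.
have cardlt z : (#|[set i : 'I_N | (q i < z)%R]%SET| < N.+1)%N.
  by rewrite ltnS -[leqRHS]card_ord max_card.
pose c z : 'I_N.+1 := Ordinal (cardlt z).
have widen_inj m (h : (m <= N)%N) : injective (widen_ord h).
  by move=> x y /(congr1 val) /= /val_inj.
(* Since [q] is increasing, the quantiles below [z] form an initial segment, so their number tells
   whether [q i] is among them. *)
have cE z (i : 'I_N) : (c z <= i)%N = (z <= q i)%R.
  apply/idP/idP => /= h.
    rewrite leNgt; apply/negP => qz.
    have : (i.+1 <= #|[set j : 'I_N | (q j < z)%R]%SET|)%N.
      rewrite -[leqLHS]card_ord.
      rewrite -(card_imset _ (widen_inj _ (ltn_ord i))).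
      apply: subset_leq_card; apply/fintype.subsetP => _ /imsetP[k _ ->]; rewrite inE.
      have := ltn_ord k; rewrite ltnS leq_eqVlt => /orP[/eqP ki|ki].
        by rewrite (_ : widen_ord _ k = i)//; exact: val_inj.
      by apply: lt_trans qz; exact: qlt.
    by rewrite ltnNge h.
  rewrite -[leqRHS](card_ord i).
  rewrite -(card_imset _ (widen_inj _ (ltnW (ltn_ord i)))).
  apply: subset_leq_card; apply/fintype.subsetP => j; rewrite inE => jz.
  have ji : (j < i)%N.
    rewrite ltnNge leq_eqVlt; apply/negP => /orP[/eqP/val_inj ij|/qlt ij].
      by move: jz; rewrite -ij ltNge h.
    by have := lt_trans (lt_le_trans jz h) ij; rewrite ltxx.
  by apply/imsetP; exists (Ordinal ji) => //; exact: val_inj.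
have cmono z z' : (z <= z')%R -> (c z <= c z')%N.
  move=> zz'; apply: subset_leq_card; apply/fintype.subsetP => i; rewrite !inE.
  by move=> /lt_le_trans; apply.
clearbody c.
have mL (i : 'I_N.+1) : measurable [set z | (c z <= i)%N] /\
    P (Z @^-1` [set z | (c z <= i)%N]) = (i.+1%:R / N.+1%:R)%:E.
  have [iN|iN] := ltnP i N.
    have -> : [set z | (c z <= i)%N] = `]-oo, q (Ordinal iN)].
      by apply/seteqP; split => z; rewrite /= in_itv/= -cE.
    by split; [exact: measurable_itv | rewrite -(qE (Ordinal iN))].
  (* The top index [N] has no quantile; its sublevel set is the whole line. *)
  have -> : [set z | (c z <= i)%N] = setT.
    apply/seteqP; split => z //= _; apply: leq_trans iN.
    by rewrite -ltnS.
  have -> : i = N :> nat by apply/eqP; rewrite eqn_leq iN -ltnS ltn_ord.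
  by split; [exact: measurableT | rewrite preimage_setT probability_setT divff].
have cell (i : 'I_N.+1) : measurable (c @^-1` [set i]) /\
    P (Z @^-1` (c @^-1` [set i])) = (N.+1%:R^-1)%:E.
  case: (posnP i) => [i0|i0].
    rewrite (_ : c @^-1` [set i] = [set z | (c z <= i)%N]).
      by have [mi ->] := mL i; split; rewrite // i0 mul1r.
    apply/seteqP; split => z /=; first by move=> ->.
    by rewrite i0 leqn0 => /eqP ci; apply: val_inj; rewrite /= ci i0.
  have lt : (i.-1 < N.+1)%N by rewrite (leq_ltn_trans (leq_pred i)).
  (* A cell is the difference of two consecutive sublevel sets. *)
  rewrite (_ : c @^-1` [set i] = [set z | (c z <= i)%N] `\`
     [set z | (c z <= Ordinal lt)%N]); last first.
    apply/seteqP; split => z /=.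
      move=> czi; split; first by rewrite czi.
      by apply/negP; rewrite -ltnNge /= prednK// czi.
    move=> [ci /negP]; rewrite -ltnNge /= prednK// => ic.
    by apply: val_inj; apply/eqP; rewrite eqn_leq ci.
  have [mi Pi] := mL i; have [mj Pj] := mL (Ordinal lt).
  split; first exact: measurableD.
  have m1 := measurable_mfun_preimage Z mi.
  have m2 := measurable_mfun_preimage Z mj.
  have -> (A B : set R) : Z @^-1` (A `\` B) = Z @^-1` A `\` Z @^-1` B by [].
  rewrite measureD//; last by rewrite ltey_eq fin_num_measure.
  rewrite setIidr; last by move=> w h; apply: leq_trans h (leq_pred _).
  apply: (etrans (congr2 (fun x y => x - y) Pi Pj)).
  rewrite /= prednK// -EFinB; congr (_%:E).
  by rewrite -mulrBl -natrB// subSnn mul1r.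
by exists c; split => // i; have [] := cell i.
Qed.

End GridCells.

(** * The support of [Z] is measurable and has full mass *)

Section Support.
Context d (T : measurableType d) (R : realType) (P : probability T R).
Variable Z : {RV P >-> R}.

(** An enumeration of the open intervals with rational endpoints that [Z] almost surely avoids;
    every other code gives the empty set. *)
Let null_rat_itv (k : nat) : set R :=
  if @unpickle (rat * rat)%type k is Some (a, b) then
    if P (Z @^-1` `]ratr a, ratr b[) == 0 then `]ratr a, ratr b[%classic
    else set0
  else set0.

(** A point off the support has a null neighbourhood, which contains a rational interval around the
    point. Countability then yields both measurability and full mass. *)
Let rv_supportC : ~` rv_support Z = \bigcup_k null_rat_itv k.
Proof.
apply/seteqP; split => [z /= /existsNP[U /not_implyP[oU /not_implyP[Uz]]]|].
  move=> /negP; rewrite lt0e measure_ge0 andbT negbK => /eqP U0.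
  have /nbhs_ballP[e /= e0 eU] : nbhs z U by exact: open_nbhs_nbhs.
  have zBe : (z - e < z)%R by rewrite ltrBlDr ltrDl.
  have zDe : (z < z + e)%R by rewrite ltrDl.
  have [a] := rat_in_itvoo zBe; rewrite in_itv/= => /andP[ea az].
  have [b] := rat_in_itvoo zDe; rewrite in_itv/= => /andP[zb be].
  exists (pickle (a, b)); [exact: I|rewrite /null_rat_itv pickleK].
  rewrite ifT; first by rewrite /= in_itv/= az.
  rewrite eq_le measure_ge0 andbT -U0; apply: le_measure; rewrite ?inE.
  - exact: measurable_mfun_preimage.
  - by apply: measurable_mfun_preimage; exact: open_measurable.
  - move=> w /=; rewrite in_itv/= => /andP[aw wb]; apply: eU.
    rewrite -ball_normE /= ltr_distlC; apply/andP; split.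
      exact: lt_trans aw.
    exact: lt_trans be.
move=> z [k _]; rewrite /null_rat_itv.
case: unpickle => [[a b]|//]; case: ifPn => // /eqP ab0 zab /=.
move=> /(_ `]ratr a, ratr b[%classic); move=> /(_ (itv_open _ _) zab).
by rewrite /distribution /pushforward ab0 ltxx.
Qed.

Let measurable_null_rat_itv k : measurable (null_rat_itv k).
Proof.
by rewrite /null_rat_itv; case: unpickle => [[a b]|//]; case: ifP.
Qed.

Lemma measurable_rv_support : measurable (rv_support Z).
Proof.
rewrite -[rv_support Z]setCK rv_supportC; apply: measurableC.
exact: bigcup_measurable.
Qed.

Lemma rv_support_full : P (Z @^-1` (~` rv_support Z)) = 0.
Proof.
have mC : measurable (Z @^-1` (~` rv_support Z)).
  by apply: measurable_mfun_preimage; exact: measurableC measurable_rv_support.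
apply/(negligibleP _ mC); rewrite rv_supportC preimage_bigcup.
apply: negligible_bigcup => k; apply/negligibleP.
  exact: measurable_mfun_preimage.
rewrite /null_rat_itv; case: unpickle => [[a b]|]; last by rewrite preimage_set0.
by case: ifPn => [/eqP//|_]; rewrite preimage_set0.
Qed.

End Support.

(** * Tail masses under SIPD *)

Section SIPDMonotone.
Context d (T : measurableType d) (R : realType) (P : probability T R).
Variables Z X : {RV P >-> R}.

(* On the support, an intermediate constant separates the conditional tail
   probabilities over A from those over A'. *)
Lemma SIPD_tail_le (A A' : set R) (x : \bar R) :
  SIPD Z X -> measurable A -> measurable A' ->
  (forall z z', A z -> A' z' -> (z <= z')%R) ->
  P (Z @^-1` A) = P (Z @^-1` A') ->
  P (Z @^-1` A `&` [set w | x < (X w)%:E]) <=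
  P (Z @^-1` A' `&` [set w | x < (X w)%:E]).
Proof.
move=> [K hK Kmono] mA mA' AA' PAA'.
case: x => [x||]; last 2 first.
- rewrite (_ : [set w | _] = set0) ?setI0 ?measure0 ?measure_ge0//.
  by apply/seteqP; split => w //=; rewrite ltNge leey.
- rewrite (_ : [set w | _] = setT) ?setIT ?PAA'//.
  by apply/seteqP; split => w //= _; rewrite ltNyr.
have -> : [set w | x%:E < (X w)%:E] = X @^-1` `]x, +oo[.
  by apply/seteqP; split => w /=; rewrite in_itv/= andbT lte_fin.
set S := rv_support Z; set B := (`]x, +oo[%classic : set R).
have mS : measurable S := measurable_rv_support Z.
have mB : measurable B by exact: measurable_itv.
have mZ C : measurable C -> measurable (Z @^-1` C).
  exact: measurable_mfun_preimage.
(* SIPD compares the kernel only at points of the support, so both sets are first cut down to it at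
   no cost in mass. *)
have inS (C : set R) (D : set T) : measurable C -> measurable D ->
    P (Z @^-1` C `&` D) = P (Z @^-1` (C `&` S) `&` D).
  move=> mC mD.
  rewrite (_ : Z @^-1` C `&` D = (Z @^-1` (C `&` S) `&` D) `|`
      (Z @^-1` (C `\` S) `&` D)); last first.
    rewrite -setIUl -preimage_setU; congr (_ @^-1` _ `&` _).
    by rewrite setDE -setIUr setUv setIT.
  have mCS : measurable (Z @^-1` (C `\` S) `&` D).
    by apply: measurableI => //; apply: mZ; exact: measurableD.
  rewrite measureU0//.
    by apply: measurableI => //; apply: mZ; exact: measurableI.
  apply/eqP; rewrite eq_le measure_ge0 andbT -(rv_support_full Z).
  apply: le_measure; rewrite ?inE//; last by move=> w [[]].
  by apply: mZ; exact: measurableC.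
have mXB : measurable (X @^-1` B) by exact: measurable_mfun_preimage.
rewrite inS// [leRHS]inS//.
have : P (Z @^-1` (A `&` S)) = P (Z @^-1` (A' `&` S)).
  move: PAA'; rewrite -[Z @^-1` A]setIT -[Z @^-1` A']setIT inS//.
  by rewrite [RHS]inS// !setIT.
have : forall z z', (A `&` S) z -> (A' `&` S) z' -> K z B <= K z' B.
  by move=> z z' [Az Sz] [Az' Sz']; apply: Kmono => //; exact: AA'.
have : measurable (A `&` S) by exact: measurableI.
have : measurable (A' `&` S) by exact: measurableI.
move: (A `&` S) (A' `&` S) => {mA mA' AA' PAA'}A {}A' mA' mA AA' PAA'.
have mK (C : set R) : measurable_fun C (fun z => K z B).
  by apply: measurable_funTS; exact: measurable_kernel.
(* The separating constant. If [A'] is empty it is [+oo], but then both sets have mass zero. *)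
pose t := ereal_inf [set K z B | z in A'].
have t0 : 0 <= t by apply: le_ereal_inf_tmp => _ [z _ <-]; exact: measure_ge0.
rewrite !hK//; apply: (@le_trans _ _ (t * distribution P Z A)).
  rewrite -integral_cst//; apply: ge0_le_integral => //.
  by move=> z Az; apply: le_ereal_inf_tmp => _ [z' Az' <-]; exact: AA'.
rewrite /distribution /pushforward PAA'.
rewrite -[P (Z @^-1` A')]/(distribution P Z A') -integral_cst//.
apply: ge0_le_integral => //.
by move=> z Az; apply: ereal_inf_lbound; exists z.
Qed.

End SIPDMonotone.

(** * Approximation of the failure probability by a grid sum *)

Lemma fsbig_finType (A : Type) (idx : A) (op : Monoid.com_law idx)
    (F : finType) (f : F -> A) :
  \big[op/idx]_(i \in [set: F]) f i = \big[op/idx]_(i : F) f i.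
Proof.
have -> : [set: F] = [set` enum F].
  by apply/seteqP; split => // i _ /=; rewrite mem_enum.
by rewrite -fsbig_seq ?enum_uniq// big_enum.
Qed.

Lemma measure_finite_cases d (T : measurableType d) (R : realType)
    (P : probability T R) (F : finType) (f : T -> F)
    (A : F -> set T) :
  (forall a, measurable (f @^-1` [set a] `&` A a)) ->
  P [set w | A (f w) w] = \sum_a P (f @^-1` [set a] `&` A a).
Proof.
move=> mfA.
have -> : [set w | A (f w) w] = \bigcup_(a in setT) (f @^-1` [set a] `&` A a).
  apply/seteqP; split => [w /= Aw|w [a _ [/= <-]]]//.
  by exists (f w).
rewrite measure_fin_bigcup; [by rewrite fsbig_finType|exact: finite_finset| |by []].
by move=> a b _ _ [w [[/= <- _] [/= <- _]]].
Qed.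

Section GridApproximation.
Context (R : realType) d0 (T0 : measurableType d0) (P0 : probability T0 R).
Variables Z X : {RV P0 >-> R}.
Context d (T : measurableType d) (P : probability T R) (n : nat).
Variables Zs Xs : 'I_n.+1 -> {RV P >-> R}.
Hypothesis hiid : iid_copies Z X Zs Xs.

Lemma iid_copies_prod (C : 'I_n.+1 -> set (R * R)) :
  (forall k, measurable (C k)) ->
  P (\bigcap_(k in setT) (rv_pair (Zs k) (Xs k) @^-1` C k)) =
  \prod_k P0 (rv_pair Z X @^-1` C k).
Proof.
move=> mC; have [/(_ [set: 'I_n.+1]%SET C mC) h1 h2] := hiid.
transitivity (\prod_(k in [set: 'I_n.+1]%SET)
    P (rv_pair (Zs k) (Xs k) @^-1` C k)).
  rewrite -h1; congr (P _); apply/seteqP; split => w hw k _; apply: hw => //=.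
  by rewrite finset.in_setT.
by apply: eq_big => [k|k _]; [rewrite finset.in_setT|exact: h2].
Qed.

Variables (N : nat) (c : R -> 'I_N.+1).
Hypothesis c_mono : forall z z', (z <= z')%R -> (c z <= c z')%N.
Hypothesis c_meas : forall i, measurable (c @^-1` [set i]).
Hypothesis c_mass : forall i,
  P0 (Z @^-1` (c @^-1` [set i])) = (N.+1%:R^-1)%:E.
Variable x : \bar R.
Hypothesis x_lty : x < +oo.
Variable m : nat.
Hypothesis m_le : (m <= n.+1)%N.

(** A joint mass; multiplied by [N.+1] it becomes the conditional probability of the tail given cell
    [i]. *)
Let cell_tail (i : 'I_N.+1) : R :=
  fine (P0 (Z @^-1` (c @^-1` [set i]) `&` [set w | x < (X w)%:E])).

Let cells w : {ffun 'I_n.+1 -> 'I_N.+1} := [ffun k => c (Zs k w)].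

Let first_cells (a : {ffun 'I_n.+1 -> 'I_N.+1}) :=
  first_indices (fun k => nat_of_ord (a k)) m.

(** The failure event with the sample ranked by cell numbers instead of by the values of [Z]. *)
Let grid_event : set T :=
  [set w | forall k, k \in first_cells (cells w) -> x < (Xs k w)%:E].

Let tail : set R := [set y | x < y%:E].

Let measurable_tail : measurable tail.
Proof.
rewrite -[X in measurable X]setTI.
by apply: emeasurable_fun_o_infty.
Qed.

Let box (a : {ffun 'I_n.+1 -> 'I_N.+1}) k : set (R * R) :=
  if k \in first_cells a then (c @^-1` [set a k]) `*` tail
  else (c @^-1` [set a k]) `*` setT.

Let measurable_box a k : measurable (box a k).
Proof. by rewrite /box; case: ifP => _; exact: measurableX. Qed.

(** Fixing all cell numbers also fixes which points are tested against [x]. The event then splits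
    into one condition per pair, and independence applies. *)
Let box_event a :
  cells @^-1` [set a] `&`
    [set w | forall k, k \in first_cells a -> x < (Xs k w)%:E] =
  \bigcap_(k in setT) (rv_pair (Zs k) (Xs k) @^-1` box a k).
Proof.
apply/seteqP; split => w.
  move=> [/= <- h] k _; rewrite /= /box ffunE.
  by case: ifPn => kJ; split => //=; exact: h.
move=> h; split => /=.
  apply/ffunP => k; rewrite ffunE; have := h k I.
  by rewrite /= /box; case: ifP => _ [].
by move=> k kJ; have := h k I; rewrite /= /box kJ => -[].
Qed.

Let measurable_rv_pair k (C : set (R * R)) : measurable C ->
  measurable (rv_pair (Zs k) (Xs k) @^-1` C).
Proof.
move=> mC; rewrite -[X in measurable X]setTI.
suff : measurable_fun setT (rv_pair (Zs k) (Xs k)) by exact.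
exact: measurable_fun_pair.
Qed.

Let grid_event_prob :
  P grid_event = (N.+1%:R^-1 ^+ n.+1 *
    grid_failure (fun i => N.+1%:R * cell_tail i) m n.+1)%:E.
Proof.
rewrite /grid_event.
rewrite (measure_finite_cases P (f := cells) (A := fun a =>
  [set w | forall k, k \in first_cells a -> x < (Xs k w)%:E])); last first.
  move=> a; rewrite box_event; apply: fin_bigcap_measurable => // k _.
  exact: measurable_rv_pair.
rewrite /grid_failure mulr_sumr -sumEFin; apply: eq_bigr => a _.
rewrite box_event iid_copies_prod//.
have E k : P0 (rv_pair Z X @^-1` box a k) = (N.+1%:R^-1 *
    (if k \in first_cells a then N.+1%:R * cell_tail (a k) else 1))%:E.
  rewrite /box; case: ifP => _.
    rewrite mulrA mulVf ?pnatr_eq0// mul1r fineK; last first.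
      apply: fin_num_measure; apply: measurableI.
        exact: measurable_mfun_preimage.
      exact: measurable_mfun_preimage measurable_tail.
    by congr (P0 _).
  rewrite mulr1 -(c_mass (a k)); congr (P0 _).
  by apply/seteqP; split => w /=; [case|].
transitivity (\prod_k (N.+1%:R^-1 *
    (if k \in first_cells a then N.+1%:R * cell_tail (a k) else 1))%:E).
  by apply: eq_bigr => k _; exact: E.
rewrite prodEFin; congr (_%:E).
by rewrite big_split /= prodr_const card_ord -big_mkcond.
Qed.

Let tie : set T := [set w | ~ injective (fun k => c (Zs k w))].

(** Diagonal pairs get the empty set, so that the union bound can range over all ordered pairs. *)
Let tie_pair (p : 'I_n.+1 * 'I_n.+1) : set T :=
  if p.1 == p.2 then set0 else [set w | c (Zs p.1 w) = c (Zs p.2 w)].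

Let tieE : tie = \bigcup_(p in setT) tie_pair p.
Proof.
apply/seteqP; split => w.
  move=> /existsNP[i /existsNP[j /not_implyP[cij ij]]].
  by exists (i, j) => //; rewrite /tie_pair /=; case: eqP.
move=> [[i j] _]; rewrite /tie_pair /=; case: eqP => //= ij cij inj.
exact/ij/inj.
Qed.

(** Two distinct points fall into a given cell with probability [N.+1 ^- 2], and there are [N.+1]
    cells. *)
Let tie_pair_prob p : measurable (tie_pair p) /\
  P (tie_pair p) <= (N.+1%:R^-1)%:E.
Proof.
case: p => i j; rewrite /tie_pair /=; case: eqP => [_|/eqP ij].
  by rewrite measure0 lee_fin invr_ge0.
have E : [set w | c (Zs i w) = c (Zs j w)] = [set w |
    (fun a => Zs j @^-1` (c @^-1` [set a])) (c (Zs i w)) w].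
  by apply/seteqP; split => w /= ->.
have mE a : measurable ((c \o Zs i) @^-1` [set a] `&`
    Zs j @^-1` (c @^-1` [set a])).
  apply: measurableI; first exact: (measurable_mfun_preimage (Zs i) (c_meas a)).
  exact: measurable_mfun_preimage.
rewrite E; split.
  apply: (measurable_finite_cases (f := c \o Zs i)
    (A := fun a => Zs j @^-1` (c @^-1` [set a]))) => a.
    exact: (measurable_mfun_preimage (Zs i) (c_meas a)).
  exact: measurable_mfun_preimage.
rewrite (measure_finite_cases P (f := c \o Zs i)
  (A := fun a => Zs j @^-1` (c @^-1` [set a])))//.
pose C a k : set (R * R) :=
  if k \in [set i; j]%SET then (c @^-1` [set a]) `*` setT else setT.
have mC a k : measurable (C a k).
  by rewrite /C; case: ifP => _ //; exact: measurableX.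
have PE a : P ((c \o Zs i) @^-1` [set a] `&` Zs j @^-1` (c @^-1` [set a])) =
    (N.+1%:R^-1 ^+ 2)%:E.
  transitivity (P (\bigcap_(k in setT) (rv_pair (Zs k) (Xs k) @^-1` C a k))).
    congr (P _); apply/seteqP; split => w /=.
      move=> [wi wj] k _ /=; rewrite /C !inE.
      by case: ifP => // /orP[] /eqP ->.
    by move=> h; have := h i I; have := h j I;
       rewrite /= /C !inE !eqxx orbT /= => -[-> _] [-> _].
  rewrite iid_copies_prod//.
  have CE k : P0 (rv_pair Z X @^-1` C a k) =
      (if k \in [set i; j]%SET then N.+1%:R^-1 else 1)%:E.
    rewrite /C; case: ifP => _; last by rewrite preimage_setT probability_setT.
    rewrite -(c_mass a); congr (P0 _).
    by apply/seteqP; split => w /=; [case|].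
  under eq_bigr => k _ do rewrite CE.
  by rewrite prodEFin -big_mkcond /= prodr_const cards2 ij.
under eq_bigr => a _ do rewrite PE.
rewrite sumEFin sumr_const card_ord -(mulr_natl (_ ^+ 2)) lee_fin.
by rewrite expr2 mulrA mulfV ?pnatr_eq0// mul1r.
Qed.

Let measurable_tie : measurable tie.
Proof.
rewrite tieE; apply: fin_bigcup_measurable => // p _.
exact: (tie_pair_prob p).1.
Qed.

Let tie_prob : P tie <= ((n.+1 ^ 2)%:R / N.+1%:R)%:E.
Proof.
apply: (@le_trans _ _ (\sum_(p \in [set: 'I_n.+1 * 'I_n.+1]) P (tie_pair p))).
  apply: content_sub_fsum; [exact: finite_finset| |exact: measurable_tie|].
    by move=> p _; exact: (tie_pair_prob p).1.
  by rewrite tieE.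
rewrite fsbig_finType.
apply: (@le_trans _ _ (\sum_(p : 'I_n.+1 * 'I_n.+1) (N.+1%:R^-1)%:E)).
  by apply: lee_sum => p _; exact: (tie_pair_prob p).2.
by rewrite sumEFin sumr_const card_prod !card_ord -(mulr_natl (_^-1)) mulnn.
Qed.

Let failure_event : set T :=
  [set w | x < min_concomitant (fun k => Zs k w) (fun k => Xs k w) m].

Let failure_grid_event w : ~ tie w -> failure_event w = grid_event w.
Proof.
move=> /contrapT cinj; rewrite /failure_event /grid_event /=.
rewrite lt_min_concomitant_inj//; last first.
  by move=> i j ij; apply: cinj; rewrite ij.
have -> : first_indices (fun k => Zs k w) m = first_cells (cells w).
  have -> : first_cells (cells w) =
      first_indices ((fun z => nat_of_ord (c z)) \o (fun k => Zs k w)) m.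
    by congr first_indices; apply: funext => k /=; rewrite ffunE.
  apply/esym/eq_first_indices; first exact: c_mono.
  by move=> i j /= /val_inj/cinj.
by apply/propext; split => [/forall_inP|h]; last exact/forall_inP.
Qed.

Let measurable_failure_event : measurable failure_event.
Proof. exact: measurable_lt_min_concomitant. Qed.

Let measurable_grid_event : measurable grid_event.
Proof.
apply: (measurable_finite_cases (f := cells) (A := fun a =>
  [set w | forall k, k \in first_cells a -> x < (Xs k w)%:E])) => a.
  rewrite (_ : cells @^-1` [set a] =
      \bigcap_(k in setT) (Zs k @^-1` (c @^-1` [set a k]))).
    by apply: fin_bigcap_measurable => // k _; exact: measurable_mfun_preimage.
  apply/seteqP; split => w /=; first by move=> <- k _ /=; rewrite ffunE.
  by move=> h; apply/ffunP => k; rewrite ffunE; exact: h.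
rewrite (_ : [set w | _] = \bigcap_(k in [set` first_cells a])
    (Xs k @^-1` tail)).
  apply: fin_bigcap_measurable => // k _; exact: measurable_mfun_preimage.
by apply/seteqP; split => w.
Qed.

(** The failure event and the grid event agree unless two points share a cell, so their
    probabilities differ by at most that of a tie. *)
Lemma failure_grid_approx :
  (`|fine (P [set w | (x < min_concomitant (fun k => Zs k w)
       (fun k => Xs k w) m)%E]) -
     N.+1%:R^-1 ^+ n.+1 * grid_failure (fun i => N.+1%:R *
       fine (P0 (Z @^-1` (c @^-1` [set i]) `&` [set w | (x < (X w)%:E)%E])))
       m n.+1|
   <= (n.+1 ^ 2)%:R / N.+1%:R)%R.
Proof.
set q := (_ * grid_failure _ _ _)%R; set e := (_ / _)%R.
rewrite -/failure_event.
have le_tie (A B : set T) : measurable A -> measurable B ->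
    (forall w, ~ tie w -> A w -> B w) -> (fine (P A) <= fine (P B) + e)%R.
  move=> mA mB AB; rewrite -lee_fin EFinD !fineK ?fin_num_measure//.
  apply: (@le_trans _ _ (P B + P tie)); last by apply: leeD2l; exact: tie_prob.
  apply: (@le_trans _ _ (P (B `|` tie))); last exact: measureU2.
  apply: le_measure; rewrite ?inE//; first exact: measurableU.
  by move=> w Aw; have [|/AB] := pselect (tie w); [right|left; auto].
have qE : q = fine (P grid_event) by rewrite grid_event_prob.
rewrite qE ler_distl lerBlDr.
by apply/andP; split; apply: le_tie => // w /failure_grid_event ->.
Qed.

End GridApproximation.

(** * Samples of consecutive sizes, and the conclusion *)

(** The two samples may live on unrelated spaces, so their events cannot be compared directly. Each
    probability is close to a grid sum that depends only on the law of [(Z, X)], and the grid sums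
    are compared. *)
Lemma SIPD_failure_succ_le (R : realType)
    d0 (T0 : measurableType d0) (P0 : probability T0 R) (Z X : {RV P0 >-> R})
    d (T : measurableType d) (P : probability T R)
    d' (T' : measurableType d') (P' : probability T' R) (n m : nat)
    (Zs Xs : 'I_n.+1 -> {RV P >-> R}) (Zs' Xs' : 'I_n.+2 -> {RV P' >-> R})
    (x : \bar R) :
  continuous_joint_distribution Z X -> SIPD Z X ->
  iid_copies Z X Zs Xs -> iid_copies Z X Zs' Xs' ->
  x < +oo -> (m <= n.+1)%N ->
  P' [set w | x < min_concomitant (fun k => Zs' k w) (fun k => Xs' k w) m] <=
  P [set w | x < min_concomitant (fun k => Zs k w) (fun k => Xs k w) m].
Proof.
move=> hcont hS hiid hiid' xlty lemn.
have lemn' : (m <= n.+2)%N by exact: leqW.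
have mF := measurable_lt_min_concomitant Zs Xs x lemn.
have mF' := measurable_lt_min_concomitant Zs' Xs' x lemn'.
rewrite -[leLHS]fineK ?fin_num_measure// -[leRHS]fineK ?fin_num_measure//.
rewrite lee_fin; set F' := fine _; set F := fine _.
(* The sum of the approximation errors for both sample sizes, up to the factor [N.+1%:R^-1]. *)
pose C : R := ((n.+1 ^ 2)%:R + (n.+2 ^ 2)%:R)%R.
suff h N : (F' - F <= C / N.+1%:R)%R.
  rewrite leNgt; apply/negP => FF'; have FF'0 : (0 < F' - F)%R by rewrite subr_gt0.
  (* For this [N], [N.+1] exceeds [C / (F' - F)], against the bound. *)
  have := h (Num.truncn (C / (F' - F))).
  rewrite ler_pdivlMr// mulrC -ler_pdivlMr// leNgt => /negP; apply.
  exact: truncnS_gt.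
have [c [cmono cmeas cmass]] :=
  no_atom_grid (continuous_joint_no_atom hcont) N.
have := failure_grid_approx hiid cmono cmeas cmass xlty lemn.
have := failure_grid_approx hiid' cmono cmeas cmass xlty lemn'.
rewrite -/F -/F'; set S := fun i => _.
rewrite ler_distl => /andP[_ h1]; rewrite ler_distl => /andP[h2 _].
have mX := measurable_lt_mfun X x.
have mcell i : measurable
    (Z @^-1` (c @^-1` [set i]) `&` [set w | x < (X w)%:E]).
  by apply: measurableI => //; exact: measurable_mfun_preimage.
have S0 i : (0 <= S i)%R by rewrite mulr_ge0// fine_ge0.
have Smono (i j : 'I_N.+1) : (i <= j)%N -> (S i <= S j)%R.
  rewrite leq_eqVlt => /orP[/eqP/val_inj -> //|ij].
  rewrite /S ler_pM2l ?ltr0n// fine_le ?fin_num_measure//.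
  apply: SIPD_tail_le => //; last by rewrite !cmass.
  move=> z z' /= czi cz'j; rewrite leNgt; apply/negP => /ltW/cmono.
  by rewrite czi cz'j leqNgt ij.
(* The additional normalising factor for the larger sample absorbs the factor [N.+1] of
   [grid_failure_succ_le]. *)
have D : (N.+1%:R^-1 ^+ n.+2 * grid_failure S m n.+2 <=
    N.+1%:R^-1 ^+ n.+1 * grid_failure S m n.+1)%R.
  rewrite exprSr -mulrA ler_wpM2l ?exprn_ge0 ?invr_ge0//.
  rewrite ler_pdivrMl ?ltr0n//; exact: grid_failure_succ_le.
rewrite lerBlDr (le_trans h1)// /C (mulrDl (n.+1 ^ 2)%:R%R (n.+2 ^ 2)%:R%R).
rewrite [leRHS]addrC addrA lerD2r.
by rewrite (le_trans D)// -lerBlDr.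
Qed.

Theorem proposition3p2 (R : realType)
    (d0 : measure_display) (T0 : measurableType d0) (P0 : probability T0 R)
    (Z X : {RV P0 >-> R})
    (hcont : continuous_joint_distribution Z X)
    (xstar : R -> \bar R) (hxstar : quantile_choice X xstar)
    (* for each n, a sample of size n on some probability space *)
    (d : nat -> measure_display) (T : forall n : nat, measurableType (d n))
    (P : forall n : nat, probability (T n) R)
    (Zs Xs : forall n : nat, 'I_n -> {RV (P n) >-> R})
    (hiid : forall n : nat, iid_copies Z X (Zs n) (Xs n)) :
  let p_success (n m : nat) (alpha : R) : \bar R :=
    success_probability (Zs n) (Xs n) m (xstar alpha) in
  [/\ SIPD Z X ->
        forall (n m : nat) (alpha : R),
          (1 <= m <= n)%N -> (0 < alpha <= 1)%R ->
          p_success n m alpha <= p_success n.+1 m alpha,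
      forall (n m : nat) (alpha : R),
        (1 <= m <= n.-1)%N -> (0 < alpha <= 1)%R ->
        p_success n m alpha <= p_success n m.+1 alpha
    & forall (n m : nat) (alpha alpha' : R),
        (1 <= m <= n)%N -> (0 < alpha <= 1)%R -> (0 < alpha' <= 1)%R ->
        (alpha <= alpha')%R ->
        p_success n m alpha <= p_success n m alpha'].
Proof.
move=> p_success; split.
- move=> hS [|n] m alpha /andP[m1 mn] a01; first by case: m m1 mn.
  rewrite /p_success; set x := xstar alpha.
  (* An infinite threshold is treated apart: every sample then succeeds, and the comparison of
     failures requires [x < +oo]. *)
  have [xy|xlty] := eqVneq x +oo.
    suff E k : success_probability (Zs k) (Xs k) m x = 1 by rewrite !E.
    rewrite /success_probability (_ : [set w | _] = setT) ?probability_setT//.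
    by apply/seteqP; split => w //= _; rewrite xy leey.
  rewrite -ltey in xlty.
  rewrite !success_probabilityC//; last exact: leqW.
  apply: leeB => //; apply: SIPD_failure_succ_le (hiid _) (hiid _) _ _ => //.
- move=> [|n] m alpha /andP[m1 mn] a01; first by case: m m1 mn.
  exact: success_probability_succ.
- move=> [|n] m alpha alpha' /andP[m1 mn] a01 a01' aa'.
    by case: m m1 mn.
  apply: le_success_probability => //.
  exact: (le_quantile_choice hxstar).
Qed.
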